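(* For every integer $n\ge1$, $$\mathrm{Pnest}_{\mathcal A(n)}(t)=\sum_{i=1}^{\lceil n/2\rceil}\binom{n}{2i-1}t^i=\frac{\sqrt t}{2}\Bigl[(1+\sqrt t)^n-(1-\sqrt t)^n\Bigr],$$ where $\mathrm{Pnest}_{\mathcal A(n)}(t)=\sum_{\mathbf a\in\mathcal A(n)}t^{\mathrm{pnest}(\mathbf a)}$ and $\mathcal A(n)$ is the set of Abelian area sequences of size $n$.
   Context: Write $[n]=\{1,\dots,n\}$. An area sequence of size $n$ is a sequence $\mathbf a=(a_1,\dots,a_n)$ of nonnegative integers with $a_i<i$ for all $i$ and $a_i\le a_{i-1}+1$ for all $i\ge 2$. Each area sequence $\mathbf a$ defines a graph $\Gamma_{\mathbf a}$ (a unit interval graph) on $[n]$ with edges $\{j,i\}$ for $1\le j<i\le n$ with $i-a_i\le j$. If $\{i,j\}$ with $i<j$ is an edge then $\{i,i+1,\dots,j\}$ is a clique. A peak-edge of $\Gamma_{\mathbf a}$ is either an isolated vertex $i$ (put $j=i$) or an edge $\{i,j\}$, $i<j$, such that neither $\{i,j+1\}$ nor $\{i-1,j\}$ is an edge (pairs not contained in $[n]$ are not edges). The corresponding peak-clique is $\{i,i+1,\dots,j\}$. The peak-nesting of a vertex is the number of peak-cliques containing it, and $\mathrm{pnest}(\mathbf a)$ is the maximum of these numbers over all vertices. An area sequence $\mathbf a$ of size $n$ is Abelian if every vertex $i\ne 1,n$ of $\Gamma_{\mathbf a}$ is adjacent to at least one of the vertices $1$ and $n$. *)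

(* Defs.v *)
From mathcomp Require Import all_boot all_order all_algebra.
Set Implicit Arguments.
Unset Strict Implicit.
Unset Printing Implicit Defensive.

Import GRing.Theory.

(* The vertex set [n] = {1, ..., n} is represented by 'I_n, the element k of
   'I_n standing for the vertex k + 1.  The condition a_i < i forces all the
   entries to be < n, so a sequence is a finite function 'I_n -> 'I_n. *)

Section AreaSequences.
Variable n : nat.
Implicit Types (a : {ffun 'I_n -> 'I_n}) (i j k v : 'I_n).

(* a_i < i reads a k < k + 1 after the index shift. *)
Definition is_area_seq a : bool :=
  [forall i : 'I_n, a i < i.+1] &&
  [forall j : 'I_n, forall i : 'I_n, (i == j.+1 :> nat) ==> (a i <= (a j).+1)].

(* The truncated subtraction is harmless, because a i <= i.  The inequality
   i - a_i <= j is unchanged when i and j are both shifted by one. *)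
Definition lower_edge a j i : bool := (j < i) && (i - a i <= j).

Definition adj a : rel 'I_n :=
  [rel i j | lower_edge a i j || lower_edge a j i].

Definition isolated a i : bool := [forall j, ~~ adj a i j].

(* When j + 1 (resp. i - 1) is not a vertex, the corresponding quantifier
   ranges over no k. *)
Definition is_peak_edge a i j : bool :=
  (i == j) && isolated a i ||
  [&& i < j, adj a i j,
      [forall k : 'I_n, (k == j.+1 :> nat) ==> ~~ adj a i k] &
      [forall k : 'I_n, (k.+1 == i :> nat) ==> ~~ adj a k j]].

Definition peak_clique i j : {set 'I_n} := [set k : 'I_n | i <= k <= j].

Definition peak_cliques a : {set {set 'I_n}} :=
  [set peak_clique e.1 e.2 | e in [set e : 'I_n * 'I_n | is_peak_edge a e.1 e.2]].

Definition peak_nesting a v : nat := #|[set C in peak_cliques a | v \in C]|.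

Definition pnest a : nat := \max_(v < n) peak_nesting a v.

Definition is_abelian a : bool :=
  [forall i : 'I_n, (i != 0 :> nat) && (i.+1 != n) ==>
    [exists k : 'I_n, ((k == 0 :> nat) || (k.+1 == n)) && adj a i k]].

Definition abelian_area_seqs : {set {ffun 'I_n -> 'I_n}} :=
  [set a | is_area_seq a && is_abelian a].

End AreaSequences.

Definition Pnest_abelian (n : nat) : {poly int} :=
  (\sum_(a in abelian_area_seqs n) 'X^(pnest a))%R.

(* Main.v *)
Require Import Defs.
From mathcomp Require Import all_boot all_order all_algebra.
From mathcomp Require Import zify.
Set Implicit Arguments.
Unset Strict Implicit.
Unset Printing Implicit Defensive.
Import GRing.Theory.

(* Let L j = j - a_j be the lower end of the clique of top j.  Then L is weakly
   increasing, the peak-cliques are the [L j, j] with j = n or L j < L (j + 1),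
   and a is Abelian iff L i is the first vertex for every i < m, where m = L n.
   In the Abelian case m lies on a maximal number of peak-cliques, so that
   pnest a is the number of distinct values of L on [m, n].
   Send a to the set S that consists of these values (the largest one is m) and
   of the x > m with L (x - 1) < L x.  The values below m and the ascents above m
   are equinumerous, so m is the median of S and #|S| = 2 pnest a - 1.
   Conversely every set S of odd size 2k - 1 comes from the a for which
   y < L j <-> #{x in S | x <= y} + k <= #{x in S | x <= j}. *)

(** * Counting the elements of a set below a bound *)

Section Rank.
Variable N : nat.
Implicit Types S : {set 'I_N.+1}.

Definition rank S (y : nat) : nat := #|[set x in S | x < y]|.

Lemma rank0 S : rank S 0 = 0.
Proof. by apply/eqP; rewrite cards_eq0; apply/eqP/setP => x; rewrite !inE andbF. Qed.

Lemma rankS S y : y <= N -> rank S y.+1 = rank S y + (inord y \in S).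
Proof.
move=> yN; have yE : (inord y : 'I_N.+1) = y :> nat by rewrite inordK.
rewrite /rank; case: (boolP (inord y \in S)) => yS.
  rewrite addn1 (cardsD1 (inord y)) inE yS yE ltnSn add1n; congr _.+1.
  apply: eq_card => x; rewrite !inE -(inj_eq val_inj) /= yE ltnS.
  by case: (x \in S) => /=; lia.
rewrite addn0; apply: eq_card => x; rewrite !inE ltnS leq_eqVlt.
case: (x =P y :> nat) => //= xy; have -> : x = inord y by apply: val_inj; rewrite /= yE.
by rewrite (negbTE yS).
Qed.

Lemma rank_full S y : N < y -> rank S y = #|S|.
Proof.
move=> Ny; apply: eq_card => x; rewrite !inE.
by rewrite (leq_trans (ltn_ord x) Ny) andbT.
Qed.

Lemma rank_mono S y z : y <= z -> rank S y <= rank S z.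
Proof.
move=> yz; apply/subset_leq_card/subsetP => x; rewrite !inE => /andP[-> /=] xy.
exact: leq_trans xy yz.
Qed.

Lemma rank_le S y : rank S y <= #|S|.
Proof. by apply/subset_leq_card/subsetP => x; rewrite inE => /andP[]. Qed.

Lemma rank_gap S y z : y <= z ->
  (forall x : 'I_N.+1, x \in S -> y <= x < z -> False) -> rank S z = rank S y.
Proof.
move=> yz gap; apply: eq_card => x; rewrite !inE.
case xS: (x \in S) => //=; have := gap x xS; lia.
Qed.

(** [rank S] climbs from 0 to [#|S|] by steps of at most one, and it leaves the value [c] exactly at
    an element of [S]. *)
Lemma rank_ivt S c : c < #|S| ->
  exists i, [/\ i <= N, inord i \in S & rank S i = c].
Proof.
rewrite -(rank_full S (ltnSn N)).
suff ivt y : y <= N.+1 -> c < rank S y ->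
    exists i, [/\ i <= N, inord i \in S & rank S i = c] by exact: ivt.
elim: y => [|y IH] yN; first by rewrite rank0.
rewrite rankS //; case: (ltnP c (rank S y)) => [cy _|yc]; first exact: IH (ltnW yN) cy.
case: (boolP (inord y \in S)) => yS; last lia.
by exists y; split => //; lia.
Qed.

End Rank.

(** * Peak-cliques described by the lower ends [low a j] *)

Section Peaks.
Variable N : nat.
Implicit Types (a : {ffun 'I_N.+1 -> 'I_N.+1}) (S : {set 'I_N.+1}).

Definition low a (j : nat) : nat := j - a (inord j).

Lemma low_le a j : low a j <= j.
Proof. exact: leq_subr. Qed.

Lemma low_ord a (i : 'I_N.+1) : low a i = i - a i.
Proof. by rewrite /low inord_val. Qed.

(** As the subtraction in [low] is exact, a_(j+1) <= a_j + 1 amounts to j - a_j <= (j+1) -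
    a_(j+1). *)
Lemma is_area_seqP a :
  reflect ((forall i : 'I_N.+1, a i <= i) /\
           (forall j, j < N -> low a j <= low a j.+1))
          (is_area_seq a).
Proof.
apply: (iffP andP) => [[/forallP h0 /forallP h1]|[h0 h1]]; split.
- by move=> i; have := h0 i; rewrite ltnS.
- move=> j jN; have /forallP/(_ (inord j.+1)) := h1 (inord j).
  rewrite !inordK ?ltnS ?(ltnW jN) // eqxx /= => h.
  have := h0 (inord j); rewrite inordK ?ltnS ?(ltnW jN) // /low.
  lia.
- by apply/forallP => i; rewrite ltnS.
- apply/forallP => j; apply/forallP => i; apply/implyP => /eqP ij.
  have jN : j < N by have := ltn_ord i; lia.
  have := h1 j jN; rewrite -ij !low_ord; have := h0 i; have := h0 j; lia.
Qed.

Lemma low_mono a i j : is_area_seq a -> i <= j <= N -> low a i <= low a j.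
Proof.
move=> /is_area_seqP[_ h]; elim: j => [|j IH] ijN; first by case: i ijN => // i; lia.
case: (ltngtP i j.+1) ijN => // [ij|->] // ijN.
by apply: leq_trans (IH _) (h _ _); lia.
Qed.

Lemma adj_lt a (i j : 'I_N.+1) : i < j -> adj a i j = (low a j <= i).
Proof. by move=> ij; rewrite /adj /= /lower_edge -!low_ord ij; lia. Qed.

Lemma adjC a (i j : 'I_N.+1) : adj a i j = adj a j i.
Proof. by rewrite /adj /= orbC. Qed.

(** A vertex from [low a N] on is the last one or adjacent to it. A smaller one needs the first
    vertex, which means that its lower end is 0. *)
Lemma is_abelianP a :
  reflect (forall i, i < low a N -> low a i = 0) (is_abelian a).
Proof.
apply: (iffP forallP) => [h i iN|h i].
  have i_lt : i < N.+1 by have := low_le a N; lia.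
  have := h (Ordinal i_lt) => /implyP /= h'.
  case: (posnP i) => [->|i0]; first by have := low_le a 0; lia.
  have {}h' : [exists k : 'I_N.+1,
      ((k == 0 :> nat) || (k.+1 == N.+1)) && adj a (Ordinal i_lt) k].
    by apply: h'; have := low_le a N; lia.
  case/existsP: h' => k /andP[/orP[/eqP k0|/eqP [kN]]].
    by rewrite adjC adj_lt /= ?k0 //; lia.
  by rewrite adj_lt /= ?kN //; have := low_le a N; lia.
apply/implyP => /andP[i0 iN]; have := ltn_ord i => i_lt.
apply/existsP; case: (ltnP i (low a N)) => iL.
  exists ord0; apply/andP; split=> //.
  by rewrite adjC adj_lt ?lt0n // h.
have iN' : i < (ord_max : 'I_N.+1) by rewrite /=; lia.
exists ord_max; apply/andP; split; first by rewrite /= eqxx orbT.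
by rewrite adj_lt.
Qed.

(** The tops of the peak-cliques. The case [j = N] stands apart because [low a N.+1] would read a
    default entry of [a]. *)
Definition peaks a : {set 'I_N.+1} :=
  [set j : 'I_N.+1 | (j == N :> nat) || (low a j < low a j.+1)].

(** An edge below [j] cannot be extended downwards iff it starts at [low a j], and then not upwards
    iff [low] increases after [j]. For [i = j] the same two conditions express isolation. *)
Lemma is_peak_edgeE a (i j : 'I_N.+1) : is_area_seq a ->
  is_peak_edge a i j = (i == low a j :> nat) && (j \in peaks a).
Proof.
move=> area_a; have mono := low_mono area_a; rewrite inE.
have leN (x : 'I_N.+1) : x <= N by rewrite -ltnS.
have lowj := low_le a j.
apply/idP/idP.
  case/orP.
    case/andP=> /eqP-> /forallP iso.
    have lj : low a j = j.
      case: (posnP j) => [j0|j0]; first lia.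
      have pj : j.-1 < N.+1 by have := leN j; lia.
      by have := iso (Ordinal pj); rewrite adjC adj_lt /=; lia.
    rewrite lj eqxx /=; case: (ltngtP j N) (leN j) => //= jN _.
    have sj : j.+1 < N.+1 by [].
    by have := iso (Ordinal sj); rewrite adj_lt //=; lia.
  case/and4P=> ij; rewrite adj_lt // => lji /forallP up /forallP down.
  apply/andP; split.
    case: (posnP i) => [i0|i0]; first lia.
    have pi : i.-1 < N.+1 by have := leN i; lia.
    have := down (Ordinal pi); rewrite adj_lt /=; lia.
  case: (ltngtP j N) (leN j) => //= jN _.
  have sj : j.+1 < N.+1 by [].
  by have := up (Ordinal sj); rewrite adj_lt /=; lia.
case/andP=> /eqP ij top; apply/orP.
case: (eqVneq i j) => [eij|nij]; [left | right]; last first.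
  have ij' : i < j by have : (i : nat) != j := nij; lia.
  apply/and4P; split => //; first by rewrite adj_lt // -ij.
    apply/forallP => k; apply/implyP => /eqP kj; rewrite adj_lt; last lia.
    by rewrite kj; have := leN k; case/orP: top => /=; lia.
  by apply/forallP => k; apply/implyP => /eqP kj; rewrite adj_lt; lia.
apply/forallP => k; rewrite eij in ij *.
case: (ltngtP k j) => [kj|jk|/val_inj ->].
- by rewrite adjC adj_lt //; lia.
- rewrite adj_lt //; have := leN k; case/orP: top => [/eqP|] jt kN; first lia.
  have : low a j.+1 <= low a k by apply: mono; lia.
  lia.
- by rewrite /adj /= /lower_edge ltnn.
Qed.

Lemma peak_nestingE a (v : 'I_N.+1) : is_area_seq a ->
  peak_nesting a v = #|[set j in peaks a | low a j <= v <= j]|.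
Proof.
move=> area_a; have low_lt (j : 'I_N.+1) : low a j < N.+1.
  by have := low_le a j; have := ltn_ord j; lia.
pose clique (j : 'I_N.+1) := peak_clique (Ordinal (low_lt j)) j.
rewrite /peak_nesting -(card_imset _ (_ : injective clique)); last first.
  (* Each top lies in its own clique, so equal cliques have equal tops. *)
  move=> i j /setP eij; apply/val_inj/eqP; rewrite eqn_leq.
  have := eij i; have := eij j; rewrite !inE !leqnn /= !low_le /=.
  by move=> /andP[_ ->] /esym/andP[_ ->].
apply: eq_card => C; rewrite inE; apply/andP/imsetP.
  case=> /imsetP[[i j]]; rewrite inE /= is_peak_edgeE // => /andP[/eqP ij pj] ->.
  rewrite inE => vij; exists j; first by rewrite inE pj -ij.
  by congr (peak_clique _ _); apply: val_inj.
case=> j; rewrite inE => /andP[pj vj] ->; split; last by rewrite inE.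
by apply/imsetP; exists (Ordinal (low_lt j), j); rewrite // inE /= is_peak_edgeE // eqxx.
Qed.

(* The vertex [m = low a N] is on all the peak-cliques of top [j >= m].  The only
   other possible one is [0, m - 1], whose vertices are not on the peak-clique of
   top [N], so none of them has a larger nesting. *)
Lemma pnestE a : is_area_seq a -> is_abelian a ->
  pnest a = #|[set j in peaks a | low a N <= j]|.
Proof.
move=> area_a /is_abelianP ab; have mono := low_mono area_a.
have leN (x : 'I_N.+1) : x <= N by rewrite -ltnS.
have m_lt : low a N < N.+1 by rewrite ltnS low_le.
have nest_m : peak_nesting a (Ordinal m_lt) = #|[set j in peaks a | low a N <= j]|.
  rewrite peak_nestingE //; apply: eq_card => j; rewrite !inE /=.
  by rewrite (mono j N) // leN leqnn.
apply/eqP; rewrite eqn_leq -{2}nest_m leq_bigmax andbT.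
apply/bigmax_leqP => v _; rewrite peak_nestingE //.
case: (leqP (low a N) v) => mv.
  apply/subset_leq_card/subsetP => j; rewrite !inE => /andP[->] /=; lia.
set A := [set j in _ | _]; set B := [set j in _ | _].
have N_in : ord_max \in B by rewrite !inE eqxx low_le.
have m0 : 0 < low a N by lia.
have pm : (low a N).-1 < N.+1 by lia.
have: A \subset (Ordinal pm) |: (B :\ ord_max).
  apply/subsetP => j; rewrite !inE -!(inj_eq val_inj) /= => /andP[pj /andP[jv vj]].
  have jN : j != N :> nat by apply/eqP => jN; move: jv; rewrite jN; lia.
  rewrite (negbTE jN) /= in pj *; rewrite pj.
  case: (ltnP j (low a N)) => jm; last by rewrite orbT.
  rewrite orbF; case: (ltnP j.+1 (low a N)) => jm'; last lia.
  by rewrite (ab _ jm) (ab _ jm') in pj.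
move/subset_leq_card => /leq_trans; apply.
by rewrite cardsU1 (cardsD1 ord_max B) N_in leq_add2r; case: (_ \notin _).
Qed.

End Peaks.

(** * The correspondence between Abelian sequences and sets of odd size *)

Section Bijection.
Variable N : nat.
Implicit Types (a : {ffun 'I_N.+1 -> 'I_N.+1}) (S : {set 'I_N.+1}).

(** The lower end L j prescribed by [S], with k = [uphalf #|S|]. For k > 0 the test succeeds at
    [y = j], so the search range suffices. *)
Definition level S (j : nat) : nat :=
  find (fun y => rank S j.+1 < rank S y.+1 + uphalf #|S|) (iota 0 j.+1).

Definition seq_of_set S : {ffun 'I_N.+1 -> 'I_N.+1} :=
  [ffun i : 'I_N.+1 => inord (i - level S i)].

Definition set_of_seq a : {set 'I_N.+1} :=
  [set x : 'I_N.+1 | [exists j : 'I_N.+1, (low a N <= j) && (low a j == x)] ||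
                     ((low a N < x) && (low a x.-1 < low a x))].

(** * From a set to a sequence and back *)

Section FromSet.
Variable S : {set 'I_N.+1}.
Hypothesis oddS : odd #|S|.

Let half_gt0 : 0 < uphalf #|S|. Proof. by case: #|S| oddS. Qed.

Let cardSE : uphalf #|S| + (uphalf #|S|).-1 = #|S|.
Proof. by have := odd_double_half #|S|; rewrite uphalf_half oddS; lia. Qed.

(** The test in [level] is monotone in [y] because [rank] is, so its first success is a
    threshold. *)
Lemma lt_level y j : (y < level S j) = (rank S y.+1 + uphalf #|S| <= rank S j.+1).
Proof.
set p := fun y => rank S j.+1 < rank S y.+1 + uphalf #|S|.
have pj : has p (iota 0 j.+1).
  by apply/hasP; exists j; rewrite ?mem_iota /p //; lia.
have lev_lt : level S j < j.+1 by move: pj; rewrite has_find size_iota.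
case: (ltnP y (level S j)) => [yl|ly].
  have := before_find 0 yl; rewrite nth_iota ?add0n; last by apply: ltn_trans yl _.
  by rewrite /p => /negbT; rewrite -leqNgt => ->.
have := nth_find 0 pj; rewrite -/(level S j) nth_iota // add0n /p.
have := rank_mono S (ly : (level S j).+1 <= y.+1); lia.
Qed.

Lemma level_le j : level S j <= j.
Proof.
by rewrite leqNgt lt_level; lia.
Qed.

Lemma low_seq_of_set j : j <= N -> low (seq_of_set S) j = level S j.
Proof.
move=> jN; have lj := level_le j.
by rewrite /low ffunE !inordK ?subKn //; lia.
Qed.

(** Since [#|S|] is 2k - 1, this makes [level S N] the k-th element, the median of [S]. *)
Lemma level_last_le j : (level S N <= j) = (uphalf #|S| <= rank S j.+1).
Proof.
rewrite leqNgt lt_level (rank_full S (ltnSn N)); lia.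
Qed.

Lemma seq_of_set_area : is_area_seq (seq_of_set S).
Proof.
apply/is_area_seqP; split=> [i|j jN].
  by rewrite ffunE inordK; have := ltn_ord i; lia.
rewrite !low_seq_of_set //; last exact: ltnW.
rewrite leqNgt lt_level -ltnNge.
have := rank_mono S (leqnSn j.+1).
by have := lt_level (level S j.+1) j.+1; rewrite ltnn; lia.
Qed.

Lemma seq_of_set_abelian : is_abelian (seq_of_set S).
Proof.
apply/is_abelianP => i; rewrite (low_seq_of_set (leqnn N)) => iN.
have iN' := leq_trans iN (level_le N).
rewrite low_seq_of_set ?(ltnW iN') //.
move: iN; rewrite ltnNge level_last_le -ltnNge => iN.
by have := lt_level 0 i; lia.
Qed.

Lemma level_ascent j : j < N -> level S N <= j ->
  (level S j < level S j.+1) = (inord j.+1 \in S).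
Proof.
move=> jN; rewrite level_last_le => kj.
have rj := rankS S (jN : j.+1 <= N).
have rN := rank_le S j.+2.
case: (boolP (_ \in S)) rj => jS rj; last first.
  by rewrite lt_level rj addn0 -lt_level ltnn.
(* When [j.+1] enters [S], the threshold on ranks rises by one and passes this [i], which is below
   [level S j.+1] but not below [level S j]. *)
have [i [iN iS ri]] : exists i, [/\ i <= N, inord i \in S & rank S i = rank S j.+1 - uphalf #|S|].
  by apply: rank_ivt; lia.
have rSi := rankS S iN; rewrite iS in rSi.
have h1 := lt_level i j; have h2 := lt_level i j.+1; lia.
Qed.

Lemma level_value (x : 'I_N.+1) : x <= level S N ->
  (x \in S) = [exists j : 'I_N.+1, (level S N <= j) && (level S j == x)].
Proof.
move=> xm.
have xN : x <= N by rewrite -ltnS.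
have := rankS S xN; rewrite inord_val => rx.
have rxk : rank S x < uphalf #|S|.
  case: (posnP x) => [->|x0]; first by rewrite rank0.
  by have := level_last_le x.-1; rewrite prednK //; lia.
apply/idP/existsP => [xS|[j /andP[]]].
  (* The element k - 1 places after [x] in [S]; it exists because [x] has fewer than k elements of
     [S] below it. *)
  have [j [jN jS rj]] : exists j, [/\ j <= N, inord j \in S &
      rank S j = rank S x + uphalf #|S| - 1] by apply: rank_ivt; lia.
  have rSj := rankS S jN; rewrite jS in rSj; rewrite xS in rx.
  exists (inord j); rewrite inordK // level_last_le rSj rj.
  apply/andP; split; first lia.
  have := lt_level x j; have := lt_level x.-1 j.
  case: (posnP x) => [x0|x0]; first lia.
  by rewrite prednK //; lia.
rewrite level_last_le => kj /eqP jx.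
have := lt_level x j; have := lt_level x.-1 j; rewrite jx ltnn.
case: (posnP x) => [x0|x0]; last rewrite prednK //; case: (x \in S) rx => //.
  by rewrite x0 rank0; lia.
lia.
Qed.

Lemma seq_of_setK : set_of_seq (seq_of_set S) = S.
Proof.
apply/setP => x; rewrite inE low_seq_of_set //.
have xN : x <= N by rewrite -ltnS.
have -> : [exists j : 'I_N.+1, (level S N <= j) && (low (seq_of_set S) j == x)] =
          [exists j : 'I_N.+1, (level S N <= j) && (level S j == x)].
  by apply: eq_existsb => j; rewrite low_seq_of_set // -ltnS.
case: (leqP x (level S N)) => xm; first by rewrite orbF -level_value.
have x0 : 0 < x by lia.
rewrite !low_seq_of_set //; last lia.
have := @level_ascent x.-1; rewrite prednK // inord_val => -> //; last lia.
case: existsP => //= -[j /andP[_ /eqP jx]].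
have jN : j <= N by rewrite -ltnS.
have := low_mono seq_of_set_area (_ : j <= N <= N).
by rewrite jN leqnn !low_seq_of_set // => /(_ isT); lia.
Qed.

Lemma pnest_seq_of_set : pnest (seq_of_set S) = uphalf #|S|.
Proof.
rewrite (pnestE seq_of_set_area seq_of_set_abelian).
set P := [set j in _ | _].
have lN := low_seq_of_set (leqnn N); have mN := level_le N.
have inP j : j <= N -> inord j \in P = ((j == N) || (inord j.+1 \in S)) && (level S N <= j).
  move=> jN; rewrite !inE inordK // lN; case: (ltngtP j N) jN => //= jN _.
  case: (leqP (level S N) j); rewrite ?andbF ?andbT // => mj.
  by rewrite !low_seq_of_set ?level_ascent // ltnW.
(* From the median on, [j] is a top iff [j.+1] is in [S]. At [j = N] this counts the k - 1 elements
   of [S] above the median, and the top [N] makes k. *)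
have step j : level S N <= j <= N -> rank P j + rank S (level S N).+1 = rank S j.+1.
  elim: j => [|j IH] mj.
    have -> : level S N = 0 by lia.
    by rewrite rank0.
  case: (ltngtP (level S N) j.+1) mj => // [mj|mj] mj'; last first.
    by rewrite mj (@rank_gap _ P 0 j.+1) ?rank0 // => x; rewrite inE lN; lia.
  rewrite [RHS]rankS ?[rank P _]rankS ?inP; try lia.
  have := IH; rewrite (_ : level S N <= j <= N); last lia.
  move=> /(_ isT); rewrite (_ : (j == N) = false); last lia.
  by rewrite (mj : level S N <= j) andbT /= => <-; rewrite addnAC.
rewrite -(rank_full P (ltnSn N)) rankS // inP // eqxx mN orTb addn1.
have := step N; rewrite mN leqnn => /(_ isT); rewrite (rank_full S (ltnSn N)).
have := level_last_le (level S N); rewrite leqnn.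
have := rankS S mN.
have rm : rank S (level S N) < uphalf #|S|.
  case: (posnP (level S N)) => [->|x0]; first by rewrite rank0.
  by have := level_last_le (level S N).-1; rewrite prednK //; lia.
by case: (_ \in S); lia.
Qed.

End FromSet.

(** * From a sequence to a set and back *)

Section FromSeq.
Variable a : {ffun 'I_N.+1 -> 'I_N.+1}.
Hypotheses (area_a : is_area_seq a) (ab_a : is_abelian a).
Let S := set_of_seq a.
Let m := low a N.

Lemma low_le_last j : j <= N -> low a j <= m.
Proof. by move=> jN; apply: low_mono; rewrite ?jN ?leqnn. Qed.

Lemma low_in_set j : m <= j <= N -> inord (low a j) \in S.
Proof.
move=> mj; have lj := low_le a j; rewrite inE inordK; last lia.
apply/orP; left; apply/existsP; exists (inord j).
by rewrite inordK ?eqxx ?andbT; lia.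
Qed.

Lemma set_of_seq_le (x : 'I_N.+1) : x \in S -> x <= m ->
  exists2 j, m <= j <= N & low a j = x.
Proof.
move=> xS xm; move: xS; rewrite inE -/m ltnNge xm orbF => /existsP[j /andP[mj /eqP jx]].
by have jN := ltn_ord j; exists (j : nat); rewrite ?mj.
Qed.

Lemma set_of_seq_gt x : m < x <= N -> (inord x \in S) = (low a x.-1 < low a x).
Proof.
move=> xm; rewrite inE inordK ?ltnS; last lia.
rewrite -/m; case/andP: (xm) => -> xN /=.
case: existsP => //= -[j /andP[mj /eqP jx]].
have jN : j <= N by rewrite -ltnS.
by have := low_le_last jN; lia.
Qed.

(** This pairs values with ascents: at an ascent from [j] to [j.+1], the element [j.+1] joins the
    left side, while on the right [low] moves past exactly one element of [S], namely [low a j]. *)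
Lemma rank_low j : m <= j <= N -> rank S j.+1 = rank S (low a j) + rank S m.+1.
Proof.
have mono := low_mono area_a.
elim: j => [|j IH] mj.
  have -> : m = 0 by lia.
  by rewrite (_ : low a 0 = 0) ?rank0 //; have := low_le a 0; lia.
case: (ltngtP m j.+1) mj => // [mj|mj] mj'; last first.
  rewrite -mj (@rank_gap _ S 0 (low a m)) ?rank0 // => x xS /andP[_ xm].
  have xm' : x <= m by have := @low_le_last m; lia.
  have [i mi ix] := set_of_seq_le xS xm'.
  have := mono m i mi; lia.
have jS := low_in_set (_ : m <= j <= N).
rewrite rankS ?IH; try lia.
rewrite set_of_seq_gt /=; last lia.
have jj : low a j <= low a j.+1 by apply: mono; lia.
have jN : low a j <= N by have := low_le a j; lia.
case: (ltngtP (low a j) (low a j.+1)) jj => // [lj|->] _; last lia.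
rewrite (@rank_gap _ S (low a j).+1 (low a j.+1)) //.
  by rewrite (rankS S jN) jS; lia.
move=> x xS /andP[jx xj].
have xm : x <= m by have := @low_le_last j.+1; lia.
have [i mi ix] := set_of_seq_le xS xm.
case: (leqP i j) => ij.
  by have := mono i j; lia.
have := mono j.+1 i; lia.
Qed.

Lemma card_set_of_seq : #|S| = (rank S m).*2.+1.
Proof.
have mN : m <= N by exact: low_le.
rewrite -(rank_full S (ltnSn N)) rank_low ?mN ?leqnn // -/m rankS //.
by rewrite low_in_set ?mN ?leqnn //; lia.
Qed.

Lemma set_of_seq_odd : odd #|S|.
Proof. by rewrite card_set_of_seq /= odd_double. Qed.

(** Both sides have the same numbers below them. For [j >= m], [rank_low] cancels k = [rank S m.+1],
    and [low a j] being in [S] turns ranks into an order comparison. For [j < m] both sides are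
    0. *)
Lemma low_level j : j <= N -> low a j = level S j.
Proof.
move=> jN; have mN : m <= N by exact: low_le.
have mS : inord m \in S by apply: (@low_in_set N); rewrite mN leqnn.
have kE : uphalf #|S| = rank S m.+1.
  by rewrite card_set_of_seq rankS // mS uphalfE /= doubleK addn1.
have ext u v : (forall y, (y < u) = (y < v)) -> u = v.
  by move=> h; have := h u; have := h v; rewrite !ltnn; lia.
apply: ext => y; rewrite lt_level ?set_of_seq_odd // kE.
case: (leqP m j) => mj.
  rewrite [rank S j.+1]rank_low ?mj // leq_add2r.
  case: (ltnP y (low a j)) => yj; first by rewrite rank_mono.
  have := rank_mono S (yj : (low a j).+1 <= y.+1).
  by rewrite rankS ?low_in_set ?mj //; have := low_le a j; lia.
have /is_abelianP/(_ _ mj) -> := ab_a.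
have := rank_mono S (mj : j.+1 <= m); rewrite (rankS S mN) mS; lia.
Qed.

Lemma set_of_seqK : seq_of_set S = a.
Proof.
have [ai_le _] := is_area_seqP a area_a.
apply/ffunP => i; have iN : i < N.+1 by exact: ltn_ord.
by rewrite ffunE -low_level // low_ord subKn ?ai_le // inord_val.
Qed.

End FromSeq.

End Bijection.

(** * Sums over sets of odd size *)

Section OddSums.
Variable V : nmodType.
Local Open Scope ring_scope.

Lemma sum_odd_sets (n : nat) (F : nat -> V) :
  \sum_(S : {set 'I_n} | odd #|S|) F #|S| =
  \sum_(k < n.+1 | odd k) F k *+ 'C(n, k).
Proof.
have card_lt (S : {set 'I_n}) : (#|S| < n.+1)%N.
  by rewrite ltnS -[X in (_ <= X)%N]card_ord max_card.
rewrite (partition_big (fun S : {set 'I_n} => Ordinal (card_lt S)) (fun k => odd k)) //=.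
apply: eq_bigr => k odd_k.
rewrite -[X in 'C(X, _)]card_ord -card_draws -sumr_const.
apply: congr_big => // S; rewrite ?inE -?(inj_eq val_inj) /=.
  by case: eqP => [->|]; rewrite ?andbF ?andbT.
by case/andP=> _ /eqP ->.
Qed.

Lemma sum_odd_ord (n : nat) (F : nat -> V) :
  \sum_(k < n.+1 | odd k) F k = \sum_(1 <= i < (uphalf n).+1) F (2 * i - 1)%N.
Proof.
elim: n => [|n IH]; first by rewrite big_mkcond big_ord_recl big_ord0 big_geq //= addr0.
rewrite big_mkcond big_ord_recr -big_mkcond /= IH uphalf_half /=.
case: (boolP (odd n)) => odd_n /=; first by rewrite addr0.
rewrite [RHS]big_nat_recr //=; congr (_ + F _).
by have := odd_double_half n; rewrite (negbTE odd_n); lia.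
Qed.

End OddSums.

(** * The generating polynomial *)

Local Open Scope ring_scope.

Lemma Pnest_abelian_odd (n : nat) : (1 <= n)%N ->
  Pnest_abelian n = \sum_(k < n.+1 | odd k) 'X^(uphalf k) *+ 'C(n, k).
Proof.
case: n => // N _; rewrite -(sum_odd_sets N.+1 (fun k => 'X^(uphalf k))) /Pnest_abelian.
(* The reindexing keeps the [S] that the round trip fixes. They are the sets of odd size, because
   [set_of_seq] of an Abelian sequence has odd size. *)
rewrite (reindex_onto (@seq_of_set N) (@set_of_seq N)) /=; last first.
  by move=> a; rewrite inE => /andP[area_a ab_a]; apply: set_of_seqK.
apply: eq_big => [S|S /andP[]]; last first.
  rewrite inE => /andP[area_S ab_S] /eqP SK.
  by rewrite pnest_seq_of_set // -SK set_of_seq_odd.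
apply/idP/idP => [/andP[]|odd_S].
  by rewrite inE => /andP[area_S ab_S] /eqP <-; apply: set_of_seq_odd.
by rewrite inE seq_of_set_area ?seq_of_set_abelian ?seq_of_setK ?eqxx.
Qed.

(* The first equality is one of polynomials in t.  In the second, s is an
   arbitrary square root of t in a commutative ring where 2 is invertible.  The
   formal identity is the case s = 'X, t = 'X^2 in {poly rat}, and the numerical
   one is the case of a real t >= 0 and s = Num.sqrt t. *)
Theorem theorem4p3 (n : nat) (hn : (1 <= n)%N) :
  Pnest_abelian n =
    \sum_(1 <= i < (uphalf n).+1) ('C(n, 2 * i - 1))%:R *: 'X^i
  /\
  (forall (R : comUnitRingType) (s t : R),
     (2%:R : R) \is a GRing.unit -> s ^+ 2 = t ->
     (map_poly intr (Pnest_abelian n)).[t]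
        = s / 2%:R * ((1 + s) ^+ n - (1 - s) ^+ n)).
Proof.
rewrite Pnest_abelian_odd //; split=> [|R s t unit2 st].
  rewrite (sum_odd_ord n (fun k => 'X^(uphalf k) *+ 'C(n, k))).
  rewrite !big_nat; apply: eq_bigr => i /andP[i1 _]; rewrite scaler_nat.
  by congr ('X^_ *+ _); rewrite uphalf_half; lia.
(* In the difference of binomial expansions the even powers of [s] cancel and the odd ones double;
   the factor s/2 turns 2 s^k into s^(k+1), a power of [t]. *)
rewrite rmorph_sum horner_sum exprDn exprBn -sumrB mulr_sumr big_mkcond /=.
apply: eq_bigr => k _; rewrite !expr1n mulr1 mul1r -signr_odd.
case: ifP => odd_k; last by rewrite expr0 mul1r subrr mulr0.
rewrite rmorphMn rmorphXn /= map_polyX hornerMn hornerXn expr1 mulN1r mulNrn opprK.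
rewrite -mulrnDl mulrnAr -mulr2n -(mulr_natl (s ^+ k) 2) mulrA divrK // -exprS -st -exprM.
by congr (s ^+ _ *+ _); rewrite uphalf_half odd_k; lia.
Qed.
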